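(* Let $d\ge 2$ and let $(U,V)\in\mathbb{R}^d\times\mathbb{R}^d$ be a couple of random vectors which are centered, $\mathbb{E}(U)=\mathbb{E}(V)=0$, and normalized, $\mathbb{E}|U|^2=\mathbb{E}|V|^2=1$. Let $(U_\ast,V_\ast)$ be an i.i.d. copy of $(U,V)$. Then $$f\big(\mathbb{E}|U-V|^2\big)\le \min\big(\kappa_{\mathbb{E}(U\otimes U)},\kappa_{\mathbb{E}(V\otimes V)}\big)\;\mathbb{E}\Big(|U-U_\ast|^2|V-V_\ast|^2-\big((U-U_\ast)\cdot(V-V_\ast)\big)^2\Big).$$ Moreover, equality holds as soon as the following two conditions are both satisfied: (i) $\frac{U}{|U|}=\frac{V}{|V|}$ almost surely; (ii) either $\mathbb{E}(U\otimes V)=\mathbb{E}(U\otimes U)=\frac1d\mathrm{Id}$ or $\mathbb{E}(U\otimes V)=\mathbb{E}(V\otimes V)=\frac1d\mathrm{Id}$.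
   Context: $f:[0,4]\to[0,1]$ is $f(x)=x-\frac{x^2}{4}$. For a symmetric non-negative $d\times d$ matrix $S$ of trace $1$, with largest eigenvalue $\|S\|\le 1$, $\kappa_S=(1-\|S\|)^{-1}\in[\frac{d}{d-1},+\infty]$, with $\kappa_S=+\infty$ if $\|S\|=1$. If both condition numbers are $+\infty$, the right-hand side of the inequality is read as $+\infty$. The expectation on the right-hand side takes values in $[0,+\infty]$. $x\cdot y$ and $|x|$ are the Euclidean inner product and norm; $\mathbb{E}(X\otimes Y)$ is the matrix with entries $\mathbb{E}(X^iY^j)$. *)

(* Defs.v *)
From HB Require Import structures.
From mathcomp Require Import all_boot all_order all_algebra.
From mathcomp Require Import all_classical all_reals all_analysis.

Set Implicit Arguments.
Unset Strict Implicit.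
Unset Printing Implicit Defensive.

Import Order.TTheory GRing.Theory Num.Theory.
Import numFieldNormedType.Exports.

Local Open Scope classical_set_scope.
Local Open Scope ring_scope.

(* The library norm on ['rV[R]_d] is the sup norm, which induces the usual
   topology; the Euclidean norm is [enorm] below. *)
Definition borelRV (R : realType) (d : nat) :=
  g_sigma_algebraType (@open 'rV[R]_d).

Definition dotv (R : realType) (d : nat) (x y : 'rV[R]_d) : R :=
  \sum_(i < d) x ord0 i * y ord0 i.

Definition enorm (R : realType) (d : nat) (x : 'rV[R]_d) : R :=
  Num.sqrt (dotv x x).

Definition same_law (disp d1 : measure_display) (T : measurableType disp)
    (T1 : measurableType d1) (R : realType) (P : probability T R)
    (X Y : T -> T1) : Prop :=
  forall A : set T1, measurable A -> P (X @^-1` A) = P (Y @^-1` A).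

Definition independent (disp d1 d2 : measure_display) (T : measurableType disp)
    (T1 : measurableType d1) (T2 : measurableType d2) (R : realType)
    (P : probability T R) (X : T -> T1) (Y : T -> T2) : Prop :=
  forall (A : set T1) (B : set T2), measurable A -> measurable B ->
    P (X @^-1` A `&` Y @^-1` B) = (P (X @^-1` A) * P (Y @^-1` B))%E.

Definition iid_copy (disp d1 : measure_display) (T : measurableType disp)
    (T1 : measurableType d1) (R : realType) (P : probability T R)
    (X Xs : T -> T1) : Prop :=
  same_law P X Xs /\ independent P X Xs.

Definition centered (disp : measure_display) (T : measurableType disp)
    (R : realType) (P : probability T R) (d : nat) (X : T -> 'rV[R]_d) : Prop :=
  forall i : 'I_d, ('E_P[fun w => X w ord0 i] = 0)%E.

Definition normalized (disp : measure_display) (T : measurableType disp)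
    (R : realType) (P : probability T R) (d : nat) (X : T -> 'rV[R]_d) : Prop :=
  ('E_P[fun w => (enorm (X w) ^+ 2)%R] = 1)%E.

(* E(X (x) Y); its entries are finite as soon as X and Y are square integrable. *)
Definition Etensor (disp : measure_display) (T : measurableType disp)
    (R : realType) (P : probability T R) (d : nat) (X Y : T -> 'rV[R]_d)
    : 'M[R]_d :=
  \matrix_(i < d, j < d) fine ('E_P[fun w => (X w ord0 i * Y w ord0 j)%R])%E.

(* For symmetric S and d > 0 the set of real eigenvalues is finite and nonempty,
   so this supremum is the largest eigenvalue. *)
Definition max_eigenvalue (R : realType) (d : nat) (S : 'M[R]_d) : R :=
  sup [set a : R | eigenvalue S a].

Definition kappa (R : realType) (d : nat) (S : 'M[R]_d) : \bar R :=
  if max_eigenvalue S == 1 then +oo%E else ((1 - max_eigenvalue S)^-1)%:E.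

(* Only the values of [f_def] on [0, 4] matter. *)
Definition f_def (R : realType) (x : R) : R := x - x ^+ 2 / 4.

(* Product with the convention (+oo) * e = +oo even for e = 0, whereas the
   library has (+oo * 0 = 0)%E. *)
Definition mule_pinfty (R : realType) (k e : \bar R) : \bar R :=
  if k == +oo%E then +oo%E else (k * e)%E.

Definition bound (disp : measure_display) (T : measurableType disp)
    (R : realType) (P : probability T R) (d : nat) (U V Us Vs : T -> 'rV[R]_d)
    : \bar R :=
  mule_pinfty (Order.min (kappa (Etensor P U U)) (kappa (Etensor P V V)))
    ('E_P[fun w => (enorm (U w - Us w) ^+ 2 * enorm (V w - Vs w) ^+ 2
                  - dotv (U w - Us w) (V w - Vs w) ^+ 2)%R])%E.

(* [x / |x|]; with the library convention on inverses it is 0 at x = 0. *)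
Definition direction (R : realType) (d : nat) (x : 'rV[R]_d) : 'rV[R]_d :=
  (enorm x)^-1 *: x.

(* Main.v *)
From HB Require Import structures.
Require Import Defs.
From mathcomp Require Import all_boot all_order all_algebra.
From mathcomp Require Import all_classical all_reals all_analysis.
From mathcomp Require Import measurable_realfun.
From mathcomp Require Import ring lra.
Import Order.TTheory GRing.Theory Num.Theory.
Import numFieldNormedType.Exports.
Set Implicit Arguments.
Unset Strict Implicit.
Unset Printing Implicit Defensive.
Local Open Scope classical_set_scope.
Local Open Scope ring_scope.

(** Write (u, v) and (u', v') for the values of (U, V) and of its copy, S, Q, C
for the matrices E(U (x) U), E(V (x) V), E(U (x) V), and t for the trace of C.
Expanding the square gives E|U - V|^2 = 2 - 2 t, so the left-hand side of the
inequality is 1 - t^2 ([f_def_distance]).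

By Lagrange's identity the integrand on the right is the squared norm of the
wedge product of u - u' and v - v', which splits as

  (u - u') /\ (v - v') = (u /\ v + u' /\ v') - (u /\ v' + u' /\ v).

The two groups are orthogonal in L^2, because each term of their inner product
is linear in one of the two independent couples, which is centered, once the
other is fixed. Hence the expectation is at least that of the squared norm of
the second group, which only involves second moments:

  2 (1 - t^2 - (tr (S Q) - |C|^2))     ([expectation_misalignment_ge]).

Orthogonality makes sense only if u /\ v is square integrable, while U and V
only have second moments. If the expectation is infinite there is nothing to
prove. If it is finite, Fubini's theorem provides a fixed value of (u', v')
for which the wedge of the differences is square integrable, and u /\ v differs
from it by an affine function of (u, v) ([square_integrable_wedge]).

It remains to bound tr (S Q) - |C|^2 by lambda (1 - t^2), lambda being the
largest eigenvalue of S ([trace_gap_le]). The residual y = V - t U satisfies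
E|y|^2 = 1 - t^2 and E(y S y^T) = tr (S Q) - 2 t tr (S C) + t^2 |S|^2, which
exceeds tr (S Q) - |C|^2 by |C - t S|^2; so the bound follows from the Rayleigh
inequality y S y^T <= lambda |y|^2 ([max_eigenvalueP]). Altogether the
expectation is at least 2 (1 - lambda) (1 - t^2), that is, twice what the
inequality asks for, and the same holds with Q in place of S.

In the case of equality t = tr (Id / d) = 1, so that U = V almost surely. Both
sides are then zero, the condition number of Id / d being finite because
d > 1. *)

(** * Euclidean inner product *)

Section dot_product.
Context (R : realType) (d : nat).
Implicit Types (x y z : 'rV[R]_d) (S : 'M[R]_d).

Lemma dotvC x y : dotv x y = dotv y x.
Proof. by apply: eq_bigr => i _; rewrite mulrC. Qed.

Lemma dotvDl x y z : dotv (x + y) z = dotv x z + dotv y z.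
Proof. by rewrite -big_split; apply: eq_bigr => i _; rewrite mxE mulrDl. Qed.

Lemma dotvZl a x y : dotv (a *: x) y = a * dotv x y.
Proof. by rewrite mulr_sumr; apply: eq_bigr => i _; rewrite mxE mulrA. Qed.

Lemma dotvDr x y z : dotv z (x + y) = dotv z x + dotv z y.
Proof. by rewrite dotvC dotvDl !(dotvC _ z). Qed.

Lemma dotvZr a x y : dotv y (a *: x) = a * dotv y x.
Proof. by rewrite dotvC dotvZl dotvC. Qed.

Lemma dotvv_ge0 x : 0 <= dotv x x.
Proof. by apply: sumr_ge0 => i _; rewrite -expr2 sqr_ge0. Qed.

Lemma dotvv_eq0 x : dotv x x = 0 -> x = 0.
Proof.
move=> /eqP; rewrite psumr_eq0; last by move=> i _; rewrite -expr2 sqr_ge0.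
move=> /allP x0; apply/rowP => i; rewrite mxE; apply/eqP.
by have := x0 i (mem_index_enum _); rewrite mulf_eq0 orbb.
Qed.

Lemma enorm_sqr x : enorm x ^+ 2 = dotv x x.
Proof. by rewrite sqr_sqrtr// dotvv_ge0. Qed.

Lemma dotv_mulmx S x y : dotv x (y *m S) = \sum_i \sum_j S i j * (y ord0 i * x ord0 j).
Proof.
rewrite exchange_big; apply: eq_bigr => j _; rewrite mxE mulr_sumr.
by apply: eq_bigr => i _; ring.
Qed.

Lemma dotv_mulmx_sym S x y : S^T = S -> dotv x (y *m S) = dotv y (x *m S).
Proof.
move=> symS; rewrite !dotv_mulmx exchange_big; apply: eq_bigr => i _.
by apply: eq_bigr => j _; rewrite -{1}symS mxE [y _ _ * _]mulrC.
Qed.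

Lemma lagrange_identity x y :
  dotv x x * dotv y y - dotv x y ^+ 2 =
  2^-1 * \sum_i \sum_j (x ord0 i * y ord0 j - x ord0 j * y ord0 i) ^+ 2.
Proof.
pose F i j := (x ord0 i * x ord0 i) * (y ord0 j * y ord0 j).
pose H i j := (x ord0 i * y ord0 i) * (x ord0 j * y ord0 j).
have -> : dotv x x * dotv y y = \sum_i \sum_j F i j.
  by rewrite mulr_suml; apply: eq_bigr => i _; rewrite mulr_sumr.
have -> : dotv x y ^+ 2 = \sum_i \sum_j H i j.
  by rewrite expr2 mulr_suml; apply: eq_bigr => i _; rewrite mulr_sumr.
have -> : \sum_i \sum_j (x ord0 i * y ord0 j - x ord0 j * y ord0 i) ^+ 2 =
    \sum_i \sum_j F i j + \sum_i \sum_j F j i - 2 * \sum_i \sum_j H i j.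
  rewrite mulr_sumr -big_split -sumrB; apply: eq_bigr => i _.
  rewrite mulr_sumr -big_split -sumrB; apply: eq_bigr => j _.
  by rewrite /F /H /=; ring.
by rewrite [\sum_i \sum_j F j i]exchange_big /=; field.
Qed.

Lemma cauchy_schwarz x y : dotv x y ^+ 2 <= dotv x x * dotv y y.
Proof.
rewrite -subr_ge0 lagrange_identity mulr_ge0// ?invr_ge0//.
by apply: sumr_ge0 => i _; apply: sumr_ge0 => j _; rewrite sqr_ge0.
Qed.

Lemma continuous_quadratic S : continuous (fun x => dotv x (x *m S)).
Proof.
have -> : (fun x => dotv x (x *m S)) =
    (fun x => \sum_i \sum_j S i j * (x ord0 i * x ord0 j)).
  by apply/funext => x; exact: dotv_mulmx.
apply: continuous_big => [|i _]; first exact: add_continuous.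
apply: continuous_big => [|j _]; first exact: add_continuous.
have cc (k : 'I_d) : continuous (fun x : 'rV[R]_d => x ord0 k).
  exact: coord_continuous.
move=> x.
exact: (@continuousM R _ _ _ x (@cst_continuous _ _ (S i j) x)
  (continuousM (cc i x) (cc j x))).
Qed.

End dot_product.

(** * Rayleigh quotient and largest eigenvalue *)

Section rayleigh.
Context (R : realType) (d : nat).
Implicit Types (x y z : 'rV[R]_d) (S : 'M[R]_d).

Lemma compact_unit_sphere : compact [set x : 'rV[R]_d | dotv x x = 1].
Proof.
apply: bounded_closed_compact.
  exists 1; split; first by rewrite num_real.
  move=> M M1 x /= x1; rewrite /Num.norm/= mx_normrE; apply/bigmax_leP; split.
    by rewrite (le_trans ler01)// ltW.
  move=> [i j] _ /=; rewrite ord1 (le_trans _ (ltW M1))//.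
  rewrite -(@ler_pXn2r _ 2)// ?nnegrE// expr1n -normrX ger0_norm ?sqr_ge0//.
  rewrite -x1 /dotv (bigD1 j)//= -expr2 lerDl.
  by apply: sumr_ge0 => k _; rewrite -expr2 sqr_ge0.
have -> : [set x : 'rV[R]_d | dotv x x = 1] = (fun x => dotv x (x *m 1%:M)) @^-1` [set 1].
  by apply/seteqP; split => x /=; rewrite mulmx1.
apply: preimage_closed; last exact: closed_eq.
by move=> x _; exact: continuous_quadratic.
Qed.

(** A maximizer of the quadratic form on the unit sphere, which exists by
compactness, is an eigenvector: the form a |x|^2 - x S x^T is nonnegative and
vanishes there, so its first variation vanishes too. *)
Lemma symmetric_max_eigenvector S : (0 < d)%N -> S^T = S ->
  exists c a, [/\ dotv c c = 1, c *m S = a *: c &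
    forall x, dotv x (x *m S) <= a * dotv x x].
Proof.
move=> d0 symS.
have sphere0 : [set x : 'rV[R]_d | dotv x x = 1] !=set0.
  exists (delta_mx ord0 (Ordinal d0)) => /=.
  rewrite /dotv (bigD1 (Ordinal d0))//= !mxE !eqxx mulr1.
  by rewrite big1 ?addr0// => i /negPf i0; rewrite !mxE i0 mulr0.
have [c] := compact_EVT_max sphere0 compact_unit_sphere
  (continuous_subspaceT (@continuous_quadratic _ _ S)).
rewrite inE/= => c1 cmax.
pose a := dotv c (c *m S); exists c, a.
have Sle x : dotv x (x *m S) <= a * dotv x x.
  have [/dotvv_eq0 ->|x0] := eqVneq (dotv x x) 0.
    by rewrite mul0mx -(scale0r 0) !dotvZl !mul0r mulr0.
  have xx : 0 < dotv x x by rewrite lt_neqAle eq_sym x0 dotvv_ge0.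
  pose r := (enorm x)^-1.
  have r2 : r ^+ 2 = (dotv x x)^-1 by rewrite exprVn enorm_sqr.
  have /cmax : r *: x \in [set x : 'rV[R]_d | dotv x x = 1].
    by rewrite inE/= dotvZl dotvZr mulrA -expr2 r2 mulVf.
  by rewrite -scalemxAl dotvZl dotvZr mulrA -expr2 r2 mulrC ler_pdivrMr.
split => //; apply/eqP; rewrite -subr_eq0; apply/eqP.
set y := _ - _.
have /(_ y) yy z : dotv z y = dotv z (c *m S) - a * dotv z c.
  by rewrite /y dotvDr -scaleNr dotvZr mulNr.
clearbody y.
pose q := a * dotv y y - dotv y (y *m S).
have q0 : 0 <= q by rewrite subr_ge0.
(* value of the form at c + t y; the bilinear form at (c, y) is - |y|^2 *)
have key t : 0 <= t ^+ 2 * q - 2 * t * dotv y y.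
  have := Sle (c + t *: y); rewrite -subr_ge0; congr (_ <= _).
  rewrite mulmxDl -scalemxAl !(dotvDl, dotvDr, dotvZl, dotvZr).
  rewrite (dotv_mulmx_sym c y symS) (dotvC c y) -/a c1 /q.
  by rewrite yy; ring.
apply: dotvv_eq0; apply/eqP; rewrite -sqrf_eq0 eq_le sqr_ge0 andbT.
(* the minimum is at |y|^2 / q; adding 1 avoids a division by zero and still
   gives a negative value unless y = 0 *)
have := key (dotv y y / (q + 1)).
have q1 : 0 < q + 1 by lra.
have -> : (dotv y y / (q + 1)) ^+ 2 * q - 2 * (dotv y y / (q + 1)) * dotv y y
    = - (dotv y y) ^+ 2 * ((q + 2) / (q + 1) ^+ 2).
  by field; rewrite gt_eqF.
rewrite mulNr oppr_ge0 pmulr_lle0 ?divr_gt0 ?exprn_gt0//; lra.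
Qed.

(** The supremum defining [max_eigenvalue] is attained, and it controls the
quadratic form. *)
Lemma max_eigenvalueP S : (0 < d)%N -> S^T = S ->
  (exists2 c, dotv c c = 1 & c *m S = max_eigenvalue S *: c) /\
  (forall x, dotv x (x *m S) <= max_eigenvalue S * dotv x x).
Proof.
move=> d0 symS; have [c [a [c1 cS Sle]]] := symmetric_max_eigenvector d0 symS.
suff -> : max_eigenvalue S = a by split=> //; exists c.
have eiga : eigenvalue S a.
  apply/eigenvalueP; exists c => //; apply/eqP => c0.
  by move: c1; rewrite c0 -(scale0r 0) dotvZl mul0r => /eqP; rewrite eq_sym oner_eq0.
have uba : ubound [set b | eigenvalue S b] a.
  move=> b /= /eigenvalueP[x xS x0].
  have := Sle x; rewrite xS dotvZr ler_pM2r// lt_neqAle dotvv_ge0 andbT eq_sym.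
  by apply/eqP => /dotvv_eq0 /eqP; apply/negP.
apply/eqP; rewrite eq_le; apply/andP; split.
  by apply: ge_sup => //; exists a.
by apply: ub_le_sup => //; exists a.
Qed.

Lemma max_eigenvalue_scalar b : (0 < d)%N -> max_eigenvalue (b *: 1%:M : 'M[R]_d) = b.
Proof.
move=> d0; have [|[c c1 cS] _] := @max_eigenvalueP (b *: 1%:M) d0.
  by rewrite linearZ/= tr_scalar_mx.
move: cS => /(congr1 (dotv c)).
by rewrite -scalemxAr mulmx1 !dotvZr c1 !mulr1.
Qed.

End rayleigh.

(** * Independent random variables and means *)

Section pair_of_random_variables.
Context (R : realType) (dT d1 d2 : measure_display) (T : measurableType dT)
  (T1 : measurableType d1) (T2 : measurableType d2) (P : probability T R).

(** Named so that it can carry the structure of a measurable function. *)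
Definition RV_pair (X : {RV P >-> T1}) (Y : {RV P >-> T2}) : T -> T1 * T2 :=
  fun w => (X w, Y w).

Variables (X : {RV P >-> T1}) (Y : {RV P >-> T2}).

Lemma measurable_RV_pair : measurable_fun setT (RV_pair X Y).
Proof. by apply: measurable_fun_pair. Qed.

HB.instance Definition _ :=
  @isMeasurableFun.Build _ _ _ _ (RV_pair X Y) measurable_RV_pair.

End pair_of_random_variables.

Section joint_law.
Local Open Scope ereal_scope.
Context (R : realType) (dT d1 d2 : measure_display) (T : measurableType dT)
  (T1 : measurableType d1) (T2 : measurableType d2) (P : probability T R)
  (X : {RV P >-> T1}) (Y : {RV P >-> T2}).
Hypothesis indXY : independent P X Y.

Lemma independent_joint_law (A : set (T1 * T2)) : measurable A ->
  distribution P (RV_pair X Y) A = (distribution P X \x distribution P Y) A.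
Proof.
by move=> mA; apply/esym/product_measure_unique => // B C mB mC; exact: indXY.
Qed.

Lemma independent_ge0_integral (F : T1 * T2 -> \bar R) :
  measurable_fun setT F -> (forall z, 0 <= F z) ->
  \int[P]_w F (X w, Y w) =
  \int[distribution P Y]_y \int[distribution P X]_x F (x, y).
Proof.
move=> mF F0.
have <- : \int[distribution P (RV_pair X Y)]_z F z = \int[P]_w F (X w, Y w).
  exact: ge0_integral_distribution.
rewrite -fubini_tonelli2//; apply: eq_measure_integral => A mA _.
exact: independent_joint_law.
Qed.

Lemma independent_integral (F : T1 * T2 -> \bar R) :
  measurable_fun setT F ->
  P.-integrable setT (fun w => F (X w, Y w)) ->
  \int[P]_w F (X w, Y w) =
  \int[distribution P Y]_y \int[distribution P X]_x F (x, y).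
Proof.
move=> mF iF.
have <- : \int[distribution P (RV_pair X Y)]_z F z = \int[P]_w F (X w, Y w).
  exact: integral_distribution.
rewrite [LHS](eq_measure_integral (distribution P X \x distribution P Y)); last first.
  by move=> A mA _; exact: independent_joint_law.
rewrite -integral21_prod_meas1//.
apply/integrableP; split => //.
rewrite (eq_measure_integral (distribution P (RV_pair X Y))); last first.
  by move=> A mA _; apply/esym; exact: independent_joint_law.
rewrite ge0_integral_distribution//; last exact: measurableT_comp.
by case/integrableP : iF.
Qed.

(** A nonnegative function with finite integral has a finite section: this
extracts information on [X] alone from a moment of the pair. *)
Lemma independent_section_lty (F : T1 * T2 -> R) :
  measurable_fun setT F -> (forall z, (0 <= F z)%R) ->
  \int[P]_w (F (X w, Y w))%:E < +oo ->
  exists y, \int[P]_w (F (X w, y))%:E < +oo.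
Proof.
move=> mF F0; have mEF : measurable_fun setT (EFin \o F) by exact/measurable_EFinP.
rewrite (independent_ge0_integral mEF)//.
move=> Foo; apply: contrapT => /forallNP Fy.
suff : \int[distribution P Y]_y \int[distribution P X]_x (F (x, y))%:E = +oo.
  by move=> E; rewrite /= E ltxx in Foo.
rewrite (eq_integral (cst +oo)).
  by rewrite integral_cst//= probability_setT mule1.
move=> y _ /=; apply/eqP; rewrite -leye_eq leNgt; apply/negP => lty.
apply: (Fy y); move: lty; rewrite ge0_integral_distribution//.
- by apply/measurable_EFinP/measurableT_comp => //; exact: pair2_measurable.
- by move=> x; rewrite lee_fin.
Qed.

End joint_law.

Section means.
Context (R : realType) (dT : measure_display) (T : measurableType dT)
  (P : probability T R).
Implicit Types (f g : T -> R) (a b : R).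

(** Integrability and the value of the expectation are kept together, so that
the mean of a polynomial expression is assembled from those of its monomials
without separate integrability proofs. *)
Definition has_mean f a := f \in Lfun P 1 /\ ('E_P[f] = a%:E)%E.

Lemma has_mean_fine f : f \in Lfun P 1 -> has_mean f (fine 'E_P[f]%E).
Proof. by move=> fL; split => //; rewrite fineK// expectation_fin_num. Qed.

Lemma has_mean_eq f g a b : has_mean f a -> f =1 g -> a = b -> has_mean g b.
Proof. by move=> fa /funext <- <-. Qed.

Lemma has_meanD f g a b : has_mean f a -> has_mean g b ->
  has_mean (fun w => f w + g w) (a + b).
Proof.
move=> [fL fa] [gL gb]; split; first exact: rpredD.
by have := expectationD fL gL; rewrite fa gb.
Qed.

Lemma has_meanZ c f a : has_mean f a -> has_mean (fun w => c * f w) (c * a).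
Proof.
have -> : (fun w => c * f w) = c \o* f by apply/funext => w /=; rewrite mulrC.
by move=> [fL fa]; split; [exact: Lfun_scale|rewrite expectationZl// fa].
Qed.

Lemma has_meanB f g a b : has_mean f a -> has_mean g b ->
  has_mean (fun w => f w - g w) (a - b).
Proof.
move=> fa gb; apply: has_mean_eq (has_meanD fa (has_meanZ (-1) gb)) _ _ => [w|];
  by rewrite mulN1r.
Qed.

Lemma has_mean_sum (I : finType) (F : I -> T -> R) (a : I -> R) :
  (forall i, has_mean (F i) (a i)) ->
  has_mean (fun w => \sum_i F i w) (\sum_i a i).
Proof.
move=> Fa; elim: (index_enum I) => [|i r IH].
  under eq_fun do rewrite big_nil; rewrite big_nil.
  by split; [exact: rpred0|exact: expectation_cst].
by under eq_fun do rewrite big_cons; rewrite big_cons; exact: has_meanD.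
Qed.

Lemma has_mean_le f g a b : has_mean f a -> has_mean g b ->
  (forall w, f w <= g w) -> a <= b.
Proof.
move=> fa gb fg; have [hL] := has_meanB gb fa; rewrite -subr_ge0 -lee_fin => <-.
by apply: expectation_ge0 => w; rewrite subr_ge0.
Qed.

(** The expectation of [g] may be infinite. *)
Lemma has_mean_le_expectation f g a : has_mean f a ->
  measurable_fun setT g -> (forall w, 0 <= g w) -> (forall w, f w <= g w) ->
  (a%:E <= 'E_P[g])%E.
Proof.
move=> fa mg g0 fg.
have [->|goo] := eqVneq ('E_P[g])%E +oo%E; first exact: leey.
have gL : g \in Lfun P 1.
  apply/Lfun1_integrable/integrableP; split; first exact/measurable_EFinP.
  rewrite (eq_integral (EFin \o g)) => [|w _]; last by rewrite /= ger0_norm.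
  by move: goo; rewrite unlock ltey.
have gm := has_mean_fine gL.
by rewrite gm.2 lee_fin; exact: has_mean_le fa gm fg.
Qed.

End means.

Section transfer.
Context (R : realType) (dT d1 d2 : measure_display) (T : measurableType dT)
  (T1 : measurableType d1) (T2 : measurableType d2) (P : probability T R).

Lemma same_law_ge0_integral (X Y : {RV P >-> T1}) (g : T1 -> \bar R) :
  same_law P X Y -> measurable_fun setT g -> (forall x, 0 <= g x)%E ->
  (\int[P]_w g (X w) = \int[P]_w g (Y w))%E.
Proof.
move=> XY mg g0; rewrite -[LHS](ge0_integral_distribution X)//.
rewrite -[RHS](ge0_integral_distribution Y)//.
by apply: eq_measure_integral => A mA _; exact: XY.
Qed.

Lemma same_law_has_mean (X Y : {RV P >-> T1}) (g : T1 -> R) a :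
  same_law P X Y -> measurable_fun setT g ->
  has_mean P (fun w => g (X w)) a -> has_mean P (fun w => g (Y w)) a.
Proof.
move=> XY mg [/Lfun1_integrable/integrableP[mgX gXoo] gXa].
have mgY : P.-integrable setT (EFin \o (fun w => g (Y w))).
  apply/integrableP; split; first by apply/measurable_EFinP/measurableT_comp.
  rewrite -(same_law_ge0_integral (g := fun x => `|(g x)%:E|%E) XY)//.
  by apply: measurableT_comp => //; exact/measurable_EFinP.
split; first exact/Lfun1_integrable.
rewrite -gXa unlock -[LHS](integral_distribution (X := Y) (f := EFin \o g))//; last first.
  exact/measurable_EFinP.
rewrite -[RHS](integral_distribution (X := X) (f := EFin \o g))//; last 2 first.
  exact/measurable_EFinP.
  exact/integrableP.
by apply: eq_measure_integral => A mA _; apply/esym; exact: XY.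
Qed.

Lemma independent_has_mean (X : {RV P >-> T1}) (Y : {RV P >-> T2})
    (g : T1 -> R) (h : T2 -> R) a b :
  independent P X Y -> measurable_fun setT g -> measurable_fun setT h ->
  has_mean P (fun w => g (X w)) a -> has_mean P (fun w => h (Y w)) b ->
  has_mean P (fun w => g (X w) * h (Y w)) (a * b).
Proof.
move=> XY mg mh [gL ga] [hL hb].
have mgh : measurable_fun setT (fun z : T1 * T2 => g z.1 * h z.2).
  by apply: measurable_funM; apply: measurableT_comp.
have /Lfun1_integrable gI := gL; have /Lfun1_integrable hI := hL.
have mgE : measurable_fun setT (EFin \o g) by exact/measurable_EFinP.
have mhE : measurable_fun setT (EFin \o h) by exact/measurable_EFinP.
have ghI : P.-integrable setT (EFin \o (fun w => g (X w) * h (Y w))).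
  apply/integrableP; split.
    by apply/measurable_EFinP/measurable_funM; apply: measurableT_comp.
  rewrite (independent_ge0_integral (F := fun z => `|(g z.1 * h z.2)%:E|%E) XY)//; last first.
    by apply: measurableT_comp => //; exact/measurable_EFinP.
  have -> : (\int[distribution P Y]_y \int[distribution P X]_x `|(g (x, y).1 * h (x, y).2)%:E| =
      \int[distribution P Y]_y (`|(h y)%:E| * \int[distribution P X]_x `|(g x)%:E|))%E.
    apply: eq_integral => y _; rewrite -ge0_integralZl//.
    - by apply: eq_integral => x _; rewrite -abseM -EFinM mulrC.
    - exact: measurableT_comp.
  rewrite ge0_integralZr//; [|exact: measurableT_comp|exact: integral_ge0].
  have fin1 : (\int[distribution P X]_x `|(g x)%:E| < +oo)%E.
    rewrite ge0_integral_distribution//; last exact: measurableT_comp.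
    by case/integrableP : gI.
  rewrite lte_mul_pinfty//; first exact: integral_ge0.
    rewrite ge0_fin_numE; last exact: integral_ge0.
    rewrite ge0_integral_distribution//; last exact: measurableT_comp.
    by case/integrableP : hI.
split; first exact/Lfun1_integrable.
rewrite unlock (independent_integral (F := fun z => (g z.1 * h z.2)%:E) XY)//; last first.
  exact/measurable_EFinP.
have gE : (\int[distribution P X]_x (g x)%:E = a%:E)%E.
  rewrite (integral_distribution (f := EFin \o g))//.
  by rewrite -ga unlock.
have hE : (\int[distribution P Y]_x (h x)%:E = b%:E)%E.
  rewrite (integral_distribution (f := EFin \o h))//.
  by rewrite -hb unlock.
transitivity (\int[distribution P Y]_y (a%:E * (h y)%:E))%E.
  apply: eq_integral => y _; rewrite -gE /=.
  under eq_integral do rewrite EFinM.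
  rewrite integralZr//.
  by apply: integrable_pushforward.
rewrite integralZl ?hE//.
by apply: integrable_pushforward.
Qed.

End transfer.

(** * Wedge products of independent copies *)

Section square_integrable.
Context (R : realType) (dT : measure_display) (T : measurableType dT)
  (P : probability T R).
Implicit Types (f g : T -> R).

Lemma Lfun2_sqr f : measurable_fun setT f ->
  (\int[P]_w (f w ^+ 2)%:E < +oo)%E -> f \in Lfun P 2%:E.
Proof.
move=> mf f2; rewrite inE; apply/andP; split; rewrite inE//=.
rewrite /finite_norm unlock /Lnorm poweR_lty//.
under eq_integral do rewrite /= powR_mulrn// -normrX ger0_norm ?sqr_ge0//.
by [].
Qed.

Lemma Lfun2D f g : f \in Lfun P 2%:E -> g \in Lfun P 2%:E ->
  (fun w => f w + g w) \in Lfun P 2%:E.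
Proof. exact: (Lfun_addr_closed P (lee1n 2)).2. Qed.

Lemma Lfun2Z c f : f \in Lfun P 2%:E -> (fun w => c * f w) \in Lfun P 2%:E.
Proof.
have -> : (fun w => c * f w) = c \o* f by apply/funext => w /=; rewrite mulrC.
by apply: Lfun_scale; rewrite ler1n.
Qed.

Lemma Lfun2_sub1 f : f \in Lfun P 2%:E -> f \in Lfun P 1.
Proof. by apply: Lfun_subset12; rewrite fin_num_measure. Qed.

End square_integrable.

Section independent_copies.
Context (R : realType) (dT d1 : measure_display) (T : measurableType dT)
  (M : measurableType d1) (P : probability T R) (X Y : {RV P >-> M}).
Hypotheses (XY : same_law P X Y) (indXY : independent P X Y).
Implicit Types p q r s : M -> R.

(** The second moment depends only on the law of [X], which [Y] shares. *)
Definition square_integrable p :=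
  measurable_fun setT p /\ (fun w => p (X w)) \in Lfun P 2%:E.

Definition mean2 p q := fine ('E_P[fun w => (p (X w) * q (X w))%R])%E.

Lemma mean2C p q : mean2 p q = mean2 q p.
Proof. by congr (fine 'E_P[_])%E; apply/funext => w; rewrite mulrC. Qed.

Lemma has_mean2 p q : square_integrable p -> square_integrable q ->
  has_mean P (fun w => p (X w) * q (X w)) (mean2 p q).
Proof. by move=> [_ pL] [_ qL]; apply: has_mean_fine; exact: Lfun2_mul_Lfun1. Qed.

Lemma has_mean4 p q r s :
  square_integrable p -> square_integrable q ->
  square_integrable r -> square_integrable s ->
  has_mean P (fun w => (p (X w) * q (X w)) * (r (Y w) * s (Y w)))
    (mean2 p q * mean2 r s).
Proof.
move=> pI qI rI sI; have [[mp _] [mq _] [mr _] [ms _]] := And4 pI qI rI sI.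
have mrs : measurable_fun setT (fun x => r x * s x) by exact: measurable_funM.
apply: (independent_has_mean (g := fun x => p x * q x) (h := fun x => r x * s x)) => //.
- exact: measurable_funM.
- exact: has_mean2.
- by apply: (same_law_has_mean (g := fun x => r x * s x) XY) => //; exact: has_mean2.
Qed.

Lemma has_mean_mixed0 f q : measurable_fun setT f ->
  (fun w => f (X w)) \in Lfun P 1 -> measurable_fun setT q ->
  has_mean P (fun w => q (X w)) 0 ->
  has_mean P (fun w => f (X w) * q (Y w)) 0 /\
  has_mean P (fun w => q (X w) * f (Y w)) 0.
Proof.
move=> mf fL mq q0; have fm := has_mean_fine fL; split.
  rewrite -[0](mulr0 (fine 'E_P[fun w => f (X w)]%E)).
  by apply: (independent_has_mean) => //; exact: same_law_has_mean q0.
rewrite -[0](mul0r (fine 'E_P[fun w => f (X w)]%E)).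
by apply: (independent_has_mean) => //; exact: same_law_has_mean fm.
Qed.

Section wedge.
Variables p1 p2 q1 q2 : M -> R.
Hypotheses (p1I : square_integrable p1) (p2I : square_integrable p2)
  (q1I : square_integrable q1) (q2I : square_integrable q2).

(** With p = (p1, p2) and q = (q1, q2) valued in the plane, [wedge] is p /\ q at
a point, [cross] is the polarization p(x) /\ q(y) + p(y) /\ q(x), and
[wedge_diff] is (p(x) - p(y)) /\ (q(x) - q(y)). *)
Definition wedge x := p1 x * q2 x - p2 x * q1 x.

Definition cross x y := p1 x * q2 y - p2 x * q1 y + (p1 y * q2 x - p2 y * q1 x).

Definition wedge_diff x y :=
  (p1 x - p1 y) * (q2 x - q2 y) - (p2 x - p2 y) * (q1 x - q1 y).

Lemma wedge_diffE x y : wedge_diff x y = wedge x + wedge y - cross x y.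
Proof. by rewrite /wedge_diff /wedge /cross; ring. Qed.

Lemma has_mean_cross_sqr : has_mean P (fun w => cross (X w) (Y w) ^+ 2)
  (2 * (mean2 p1 p1 * mean2 q2 q2) + 2 * (mean2 p2 p2 * mean2 q1 q1)
   - 4 * (mean2 p1 p2 * mean2 q1 q2)
   + 2 * (mean2 p1 q2 ^+ 2 + mean2 p2 q1 ^+ 2)
   - 4 * (mean2 p1 q1 * mean2 p2 q2)).
Proof.
(* each monomial of the square has two factors for each copy; each of H1
   to H5 groups two monomials with equal coefficients *)
have H1 := has_meanD (has_mean4 p1I p1I q2I q2I) (has_mean4 q2I q2I p1I p1I).
have H2 := has_meanD (has_mean4 p2I p2I q1I q1I) (has_mean4 q1I q1I p2I p2I).
have H3 := has_meanD (has_mean4 p1I p2I q2I q1I) (has_mean4 q2I q1I p1I p2I).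
have H4 := has_meanD (has_mean4 p1I q2I q2I p1I) (has_mean4 p2I q1I q1I p2I).
have H5 := has_meanD (has_mean4 p1I q1I q2I p2I) (has_mean4 p2I q2I q1I p1I).
have H6 := has_meanD (has_meanD H1 H2) (has_meanZ 2 (has_meanB (has_meanB H4 H5) H3)).
apply: has_mean_eq H6 _ _ => [w|]; first by rewrite /cross; ring.
rewrite (mean2C q2 p1) (mean2C q1 p2) (mean2C q2 q1) (mean2C q2 p2) (mean2C q1 p1).
by ring.
Qed.

Lemma measurable_wedge : measurable_fun setT wedge.
Proof.
by move: p1I p2I q1I q2I => [? _] [? _] [? _] [? _];
  apply: measurable_funB; exact: measurable_funM.
Qed.

Lemma measurable_wedge_diff : measurable_fun setT (fun z => wedge_diff z.1 z.2).
Proof.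
have mB p : square_integrable p -> measurable_fun setT (fun z : M * M => p z.1 - p z.2).
  by move=> [mp _]; apply: measurable_funB; exact: measurableT_comp.
by apply: measurable_funB; apply: measurable_funM; exact: mB.
Qed.

Hypotheses (p1c : has_mean P (fun w => p1 (X w)) 0)
  (p2c : has_mean P (fun w => p2 (X w)) 0)
  (q1c : has_mean P (fun w => q1 (X w)) 0)
  (q2c : has_mean P (fun w => q2 (X w)) 0).

Hypothesis wedge_diff_lty :
  (\int[P]_w (wedge_diff (X w) (Y w) ^+ 2)%:E < +oo)%E.

(** Only second moments of p and q are known, which does not bound p /\ q in
L^2; the finite mean of [wedge_diff] squared does, by fixing the copy at a
value where the section of [wedge_diff] is square integrable. *)
Lemma square_integrable_wedge : square_integrable wedge.
Proof.
split; first exact: measurable_wedge.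
have [||y Wy] := independent_section_lty indXY
   (F := fun z => wedge_diff z.1 z.2 ^+ 2) _ _ wedge_diff_lty.
- by apply: measurable_funX; exact: measurable_wedge_diff.
- by move=> z; exact: sqr_ge0.
have mW : measurable_fun setT (fun w => wedge_diff (X w) y).
  apply: (measurableT_comp (f := fun x => wedge_diff x y)) => //.
  exact: (measurableT_comp measurable_wedge_diff (pair2_measurable y)).
have WL := Lfun2_sqr mW Wy.
move: p1I p2I q1I q2I => [_ p1L] [_ p2L] [_ q1L] [_ q2L].
(* the section of the difference at y is the wedge up to an affine function *)
have wedgeE x : wedge x = wedge_diff x y + (q2 y * p1 x + - q1 y * p2 x)
    + (- p2 y * q1 x + p1 y * q2 x) + - wedge y * 1.
  by rewrite /wedge_diff /wedge; ring.
under eq_fun do rewrite wedgeE.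
do !apply: Lfun2D => //; apply: Lfun2Z => //; exact: Lfun_cst.
Qed.

(** Each monomial of the product is a function of one copy times a centered
coordinate of the other. *)
Lemma has_mean_wedge_cross :
  has_mean P (fun w => (wedge (X w) + wedge (Y w)) * cross (X w) (Y w)) 0.
Proof.
have [mw wL] := square_integrable_wedge.
have prod0 p q : square_integrable p -> square_integrable q ->
    has_mean P (fun w => q (X w)) 0 ->
    has_mean P (fun w => wedge (X w) * p (X w) * q (Y w)) 0 /\
    has_mean P (fun w => q (X w) * (wedge (Y w) * p (Y w))) 0.
  move=> [mp pL] [mq qL] q0.
  apply: (has_mean_mixed0 (f := fun x => wedge x * p x)) => //.
    exact: measurable_funM.
  exact: Lfun2_mul_Lfun1.
have [a1 b1] := prod0 _ _ p1I q2I q2c.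
have [a2 b2] := prod0 _ _ p2I q1I q1c.
have [a3 b3] := prod0 _ _ q2I p1I p1c.
have [a4 b4] := prod0 _ _ q1I p2I p2c.
have H := has_meanD (has_meanB (has_meanD a1 a3) (has_meanD a2 a4))
  (has_meanB (has_meanD b1 b3) (has_meanD b2 b4)).
by apply: has_mean_eq H _ _ => [w|]; rewrite /cross; ring.
Qed.

(** The minorant is [wedge_diff] squared without the square of the term
orthogonal to [cross]; dropping it leaves a mean made of second moments. *)
Lemma has_mean_wedge_diff_minorant :
  has_mean P (fun w => cross (X w) (Y w) ^+ 2
      - 2 * ((wedge (X w) + wedge (Y w)) * cross (X w) (Y w)))
  (2 * (mean2 p1 p1 * mean2 q2 q2) + 2 * (mean2 p2 p2 * mean2 q1 q1)
   - 4 * (mean2 p1 p2 * mean2 q1 q2)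
   + 2 * (mean2 p1 q2 ^+ 2 + mean2 p2 q1 ^+ 2)
   - 4 * (mean2 p1 q1 * mean2 p2 q2)).
Proof.
have := has_meanB has_mean_cross_sqr (has_meanZ 2 has_mean_wedge_cross).
by rewrite mulr0 subr0.
Qed.

Lemma wedge_diff_sqr_ge x y :
  cross x y ^+ 2 - 2 * ((wedge x + wedge y) * cross x y) <= wedge_diff x y ^+ 2.
Proof.
rewrite wedge_diffE -subr_ge0.
by rewrite [leRHS](_ : _ = (wedge x + wedge y) ^+ 2) ?sqr_ge0//; ring.
Qed.

End wedge.
End independent_copies.

(** * Second moments of random vectors *)

Section borel_vectors.
Context (R : realType) (d : nat).

Lemma measurable_coord i : measurable_fun setT (fun x : borelRV R d => x ord0 i).
Proof.
apply: (measurability _ (RGenOInfty.measurableE R)) => //.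
move=> _ [_ [x ->] <-]; rewrite setTI; apply: sub_sigma_algebra.
apply: open_comp => [y _|]; last exact: interval_open.
exact: coord_continuous.
Qed.

Lemma measurable_dotv (dT : measure_display) (T : measurableType dT)
    (f g : T -> 'rV[R]_d) :
  (forall i, measurable_fun setT (fun w => f w ord0 i)) ->
  (forall i, measurable_fun setT (fun w => g w ord0 i)) ->
  measurable_fun setT (fun w => dotv (f w) (g w)).
Proof. by move=> mf mg; apply: measurable_sum => i; exact: measurable_funM. Qed.

End borel_vectors.

Section second_moments.
Context (R : realType) (dT : measure_display) (T : measurableType dT)
  (P : probability T R) (d : nat).
Implicit Types (U V : {RV P >-> borelRV R d}).

Lemma measurable_RVcoord U i : measurable_fun setT (fun w => U w ord0 i).
Proof. exact: measurableT_comp (measurable_coord i) _. Qed.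

Lemma normalized_Lfun2 U i : normalized P U ->
  (fun w => U w ord0 i) \in Lfun P 2%:E.
Proof.
move=> U1; apply: Lfun2_sqr; first exact: measurable_RVcoord.
apply: (@le_lt_trans _ _ 1%E); last exact: ltry.
rewrite -U1 unlock; apply: ge0_le_integral => //.
- by move=> w _; rewrite lee_fin sqr_ge0.
- by apply/measurable_EFinP/measurable_funX; exact: measurable_RVcoord.
- apply/measurable_EFinP; under eq_fun do rewrite enorm_sqr.
  by apply: measurable_dotv => j; exact: measurable_RVcoord.
- move=> w _; rewrite lee_fin enorm_sqr /dotv (bigD1 i)//= expr2 lerDl.
  by apply: sumr_ge0 => j _; rewrite -expr2 sqr_ge0.
Qed.

Lemma Etensor_tr U V : (Etensor P U V)^T = Etensor P V U.
Proof.
apply/matrixP => i j; rewrite !mxE; congr (fine 'E_P[_])%E.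
by apply/funext => w; rewrite mulrC.
Qed.

Lemma has_mean_Etensor U V i j : normalized P U -> normalized P V ->
  has_mean P (fun w => U w ord0 i * V w ord0 j) (Etensor P U V i j).
Proof.
move=> U1 V1; rewrite mxE; apply: has_mean_fine.
by apply: Lfun2_mul_Lfun1; exact: normalized_Lfun2.
Qed.

Lemma has_mean_dotv U V : normalized P U -> normalized P V ->
  has_mean P (fun w => dotv (U w) (V w)) (\tr (Etensor P U V)).
Proof. by move=> U1 V1; apply: has_mean_sum => i; exact: has_mean_Etensor. Qed.

Lemma normalized_trace U : normalized P U -> \tr (Etensor P U U) = 1.
Proof.
move=> U1; have [_] := has_mean_dotv U1 U1.
by move: U1; rewrite /normalized; under eq_fun do rewrite enorm_sqr; move=> -> [].
Qed.

Lemma has_mean_residual U V t : normalized P U -> normalized P V ->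
  has_mean P (fun w => dotv (V w - t *: U w) (V w - t *: U w))
    (1 - 2 * t * \tr (Etensor P U V) + t ^+ 2).
Proof.
move=> U1 V1.
have H := has_meanD (has_meanB (has_mean_dotv V1 V1)
  (has_meanZ (2 * t) (has_mean_dotv U1 V1))) (has_meanZ (t ^+ 2) (has_mean_dotv U1 U1)).
apply: has_mean_eq H _ _ => [w|]; last by rewrite !normalized_trace// mulr1.
by rewrite -[in RHS]scaleNr !(dotvDl, dotvDr, dotvZl, dotvZr) (dotvC (V w) (U w)); ring.
Qed.

(** 1 - t^2 is the mean square of the residual of the regression of [V] on
[U]. *)
Lemma correlation_sqr_le1 U V : normalized P U -> normalized P V ->
  \tr (Etensor P U V) ^+ 2 <= 1.
Proof.
move=> U1 V1; set t := \tr _.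
have := has_mean_le (has_mean_fine (Lfun_cst P 0 1)) (has_mean_residual t U1 V1).
have -> : fine ('E_P[cst 0%R])%E = 0 :> R by rewrite expectation_cst.
move=> /(_ (fun w => dotvv_ge0 _)); rewrite -/t; lra.
Qed.

(** For a unit eigenvector c, the eigenvalue is the mean of (c . U)^2, which is
at most |U|^2. *)
Lemma max_eigenvalue_Etensor_le1 U : (0 < d)%N -> normalized P U ->
  max_eigenvalue (Etensor P U U) <= 1.
Proof.
move=> d0 U1.
have [[c c1 cS] _] := max_eigenvalueP d0 (Etensor_tr U U).
have cSc : has_mean P (fun w => dotv c (U w) ^+ 2) (max_eigenvalue (Etensor P U U)).
  have -> : max_eigenvalue (Etensor P U U) =
      \sum_i \sum_j (c ord0 i * c ord0 j) * Etensor P U U i j.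
    rewrite -[LHS]mulr1 -c1 -dotvZr -cS dotv_mulmx.
    by apply: eq_bigr => i _; apply: eq_bigr => j _; rewrite mulrC.
  apply: has_mean_eq (has_mean_sum (fun i => has_mean_sum (fun j =>
    has_meanZ (c ord0 i * c ord0 j) (has_mean_Etensor i j U1 U1)))) _ erefl => w.
  rewrite expr2 mulr_suml; apply: eq_bigr => i _; rewrite mulr_sumr.
  by apply: eq_bigr => j _; ring.
rewrite -(normalized_trace U1).
apply: has_mean_le cSc (has_mean_dotv U1 U1) _ => w.
by rewrite -[leRHS]mul1r -c1 cauchy_schwarz.
Qed.

(** The Rayleigh inequality integrated along the residual V - t U: the left-hand
side is at most E(y S y^T) for y = V - t U, and E|y|^2 = 1 - t^2. *)
Lemma trace_gap_le U V : (0 < d)%N -> normalized P U -> normalized P V ->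
  \sum_i \sum_j Etensor P U U i j * Etensor P V V i j
    - \sum_i \sum_j Etensor P U V i j ^+ 2 <=
  max_eigenvalue (Etensor P U U) * (1 - \tr (Etensor P U V) ^+ 2).
Proof.
move=> d0 U1 V1; set t := \tr _; set lam := max_eigenvalue _.
pose S := Etensor P U U; pose Q := Etensor P V V; pose C := Etensor P U V.
have symS : S^T = S by exact: Etensor_tr.
have [_ Sle] := max_eigenvalueP d0 symS.
have CT i j : Etensor P V U i j = C j i by rewrite -(Etensor_tr U V) mxE.
have entry i j : has_mean P
    (fun w => (V w - t *: U w) ord0 i * (V w - t *: U w) ord0 j)
    (Q i j - t * C i j - t * C j i + t ^+ 2 * S i j).
  have H := has_meanD (has_meanB (has_meanB (has_mean_Etensor i j V1 V1)
    (has_meanZ t (has_mean_Etensor i j U1 V1))) (has_meanZ t (has_mean_Etensor i j V1 U1)))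
    (has_meanZ (t ^+ 2) (has_mean_Etensor i j U1 U1)).
  by apply: has_mean_eq H _ _ => [w|]; [rewrite !mxE; ring|rewrite CT].
have quad : has_mean P
    (fun w => dotv (V w - t *: U w) ((V w - t *: U w) *m S))
    (\sum_i \sum_j S i j * (Q i j - t * C i j - t * C j i + t ^+ 2 * S i j)).
  apply: has_mean_eq (has_mean_sum (fun i => has_mean_sum (fun j =>
    has_meanZ (S i j) (entry i j)))) _ erefl => w.
  by rewrite dotv_mulmx.
have := has_mean_le quad (has_meanZ lam (has_mean_residual t U1 V1)) (fun w => Sle _).
have -> : lam * (1 - 2 * t * \tr (Etensor P U V) + t ^+ 2) = lam * (1 - t ^+ 2).
  by rewrite -/t; ring.
apply: le_trans; rewrite -subr_ge0.
have symC : \sum_i \sum_j S i j * C j i = \sum_i \sum_j S i j * C i j.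
  rewrite exchange_big; apply: eq_bigr => i _; apply: eq_bigr => j _.
  by rewrite -{1}symS mxE.
(* what is left over is the square of the Frobenius norm of C - t S *)
have -> : \sum_i \sum_j S i j * (Q i j - t * C i j - t * C j i + t ^+ 2 * S i j)
    - (\sum_i \sum_j S i j * Q i j - \sum_i \sum_j C i j ^+ 2)
    = \sum_i \sum_j (C i j - t * S i j) ^+ 2
      + t * (\sum_i \sum_j S i j * C i j - \sum_i \sum_j S i j * C j i).
  rewrite -!sumrB mulr_sumr -big_split; apply: eq_bigr => i _ /=.
  rewrite -!sumrB mulr_sumr -big_split; apply: eq_bigr => j _ /=; ring.
rewrite symC subrr mulr0 addr0.
by apply: sumr_ge0 => i _; apply: sumr_ge0 => j _; exact: sqr_ge0.
Qed.

End second_moments.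

(** * Lower bound for the expected misalignment *)

(** The sum over the coordinate planes of the means in
[has_mean_wedge_diff_minorant]; the factor 1/2 accounts for each plane being
counted for both orders of its coordinates. *)
Lemma sum_cross_entries (R : realType) (d : nat) (S Q C : 'M[R]_d) :
  2^-1 * \sum_i \sum_j (2 * (S i i * Q j j) + 2 * (S j j * Q i i)
    - 4 * (S i j * Q i j) + 2 * (C i j ^+ 2 + C j i ^+ 2) - 4 * (C i i * C j j))
  = 2 * (\tr S * \tr Q - \tr C ^+ 2
         - (\sum_i \sum_j S i j * Q i j - \sum_i \sum_j C i j ^+ 2)).
Proof.
have trM (A B : 'M[R]_d) : \tr A * \tr B = \sum_i \sum_j A i i * B j j.
  by rewrite mulr_suml; apply: eq_bigr => i _; rewrite mulr_sumr.
rewrite expr2 !trM; set a := \sum_i \sum_j S i i * _; set e := \sum_i \sum_j C i i * _.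
set b := \sum_i \sum_j S i j * _; set c := \sum_i \sum_j C i j ^+ 2.
have -> : 2 * (a - e - (b - c)) = 2^-1 * (2 * a + 2 * a - 4 * b + 2 * (c + c) - 4 * e).
  by field.
have aE : a = \sum_i \sum_j S j j * Q i i by exact: exchange_big.
have cE : c = \sum_i \sum_j C j i ^+ 2 by exact: exchange_big.
rewrite {2}aE {2}cE /a /b /c /e; congr (_ * _).
rewrite !mulr_sumr -!big_split -!sumrB mulr_sumr -big_split -sumrB /=.
apply: eq_bigr => i _.
by rewrite !mulr_sumr -!big_split -!sumrB mulr_sumr -big_split -sumrB.
Qed.

Section alignment.
Context (R : realType) (dT : measure_display) (T : measurableType dT)
  (P : probability T R) (d : nat) (U V Us Vs : {RV P >-> borelRV R d}).
Hypotheses (Uc : centered P U) (Vc : centered P V)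
  (U1 : normalized P U) (V1 : normalized P V)
  (copy : iid_copy P (RV_pair U V) (RV_pair Us Vs)).

Definition misalignment w : R :=
  enorm (U w - Us w) ^+ 2 * enorm (V w - Vs w) ^+ 2
  - dotv (U w - Us w) (V w - Vs w) ^+ 2.

Let Z : {RV P >-> (borelRV R d * borelRV R d)%type} := RV_pair U V.
Let Zs : {RV P >-> (borelRV R d * borelRV R d)%type} := RV_pair Us Vs.
Let u i (z : borelRV R d * borelRV R d) := z.1 ord0 i.
Let v i (z : borelRV R d * borelRV R d) := z.2 ord0 i.
Let W i j := wedge_diff (u i) (u j) (v i) (v j).

Lemma misalignmentE w :
  misalignment w = 2^-1 * \sum_i \sum_j W i j (Z w) (Zs w) ^+ 2.
Proof.
rewrite /misalignment !enorm_sqr lagrange_identity; congr (_ * _).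
apply: eq_bigr => i _; apply: eq_bigr => j _.
by rewrite !mxE.
Qed.

Lemma misalignment_ge0 w : 0 <= misalignment w.
Proof. by rewrite /misalignment !enorm_sqr subr_ge0 cauchy_schwarz. Qed.

Lemma measurable_misalignment : measurable_fun setT misalignment.
Proof.
have mB (X Y : {RV P >-> borelRV R d}) i : measurable_fun setT (fun w => (X w - Y w) ord0 i).
  under eq_fun do rewrite !mxE.
  by apply: measurable_funB; exact: measurable_RVcoord.
rewrite /misalignment; under eq_fun do rewrite !enorm_sqr.
apply: measurable_funB.
  by apply: measurable_funM; apply: measurable_dotv => i; exact: mB.
by apply: measurable_funX; apply: measurable_dotv => i; exact: mB.
Qed.

Let uI i : square_integrable Z (u i).
Proof.
split; last exact: normalized_Lfun2.
exact: measurableT_comp (measurable_coord i) _.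
Qed.

Let vI i : square_integrable Z (v i).
Proof.
split; last exact: normalized_Lfun2.
exact: measurableT_comp (measurable_coord i) _.
Qed.

Let uc i : has_mean P (fun w => u i (Z w)) 0.
Proof. by split; [apply/Lfun2_sub1/normalized_Lfun2|exact: Uc]. Qed.

Let vc i : has_mean P (fun w => v i (Z w)) 0.
Proof. by split; [apply/Lfun2_sub1/normalized_Lfun2|exact: Vc]. Qed.

(** Summing over the coordinate planes the lower bound for a single one. If the
expectation is infinite the bound is trivial; otherwise each plane contributes
a finite amount, as needed for the orthogonality argument. *)
Lemma expectation_misalignment_ge :
  ((2 * (1 - \tr (Etensor P U V) ^+ 2
     - (\sum_i \sum_j Etensor P U U i j * Etensor P V V i j
       - \sum_i \sum_j Etensor P U V i j ^+ 2)))%:E <= 'E_P[misalignment])%E.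
Proof.
have [->|goo] := eqVneq ('E_P[misalignment])%E +oo%E; first exact: leey.
have [ZZs indZ] := copy.
have W_lty i j : (\int[P]_w (W i j (Z w) (Zs w) ^+ 2)%:E < +oo)%E.
  apply: (@le_lt_trans _ _ (2%:E * 'E_P[misalignment])%E); last first.
    by rewrite lte_mul_pinfty// ltey.
  rewrite unlock -ge0_integralZl//; last 2 first.
    exact/measurable_EFinP/measurable_misalignment.
    by move=> w _; rewrite lee_fin misalignment_ge0.
  apply: ge0_le_integral => //.
  - by move=> w _; rewrite lee_fin sqr_ge0.
  - apply/measurable_EFinP/measurable_funX.
    exact: (measurableT_comp (measurable_wedge_diff (uI i) (uI j) (vI i) (vI j))
      (measurable_RV_pair Z Zs)).
  - apply/measurable_EFinP/measurable_funM => //; exact: measurable_misalignment.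
  - move=> w _; rewrite -EFinM lee_fin misalignmentE mulrA mulfV ?mul1r//.
    rewrite (bigD1 i)//= (bigD1 j)//= -addrA lerDl addr_ge0//.
      by apply: sumr_ge0 => k _; rewrite sqr_ge0.
    by apply: sumr_ge0 => k _; apply: sumr_ge0 => l _; rewrite sqr_ge0.
have minor i j := has_mean_wedge_diff_minorant ZZs indZ (uI i) (uI j) (vI i) (vI j)
  (uc i) (uc j) (vc i) (vc j) (W_lty i j).
have H := has_meanZ 2^-1 (has_mean_sum (fun i => has_mean_sum (minor i))).
have K := has_mean_le_expectation H measurable_misalignment misalignment_ge0.
apply: le_trans (K _); last first.
  move=> w; rewrite misalignmentE ler_wpM2l ?invr_ge0//.
  by apply: ler_sum => i _; apply: ler_sum => j _; exact: wedge_diff_sqr_ge.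
rewrite lee_fin.
have uu i j : mean2 Z (u i) (u j) = Etensor P U U i j by rewrite mxE.
have vv i j : mean2 Z (v i) (v j) = Etensor P V V i j by rewrite mxE.
have uv i j : mean2 Z (u i) (v j) = Etensor P U V i j by rewrite mxE.
under [in leRHS]eq_bigr do under eq_bigr do rewrite !uu !vv !uv.
by rewrite sum_cross_entries !normalized_trace// mulr1.
Qed.

End alignment.

(** * Condition numbers, distance and conclusion *)

Lemma le_mule_kappa (R : realType) (d : nat) (S : 'M[R]_d) (x : R) (e : \bar R) :
  max_eigenvalue S <= 1 -> (((1 - max_eigenvalue S) * x)%:E <= e)%E ->
  (x%:E <= mule_pinfty (kappa S) e)%E.
Proof.
rewrite /mule_pinfty /kappa => lam1; have [_|lamN1] := eqVneq (max_eigenvalue S) 1 => xe /=.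
  by rewrite leey.
have lam_lt1 : 0 < 1 - max_eigenvalue S by rewrite subr_gt0 lt_neqAle lamN1.
have -> : x = (1 - max_eigenvalue S)^-1 * ((1 - max_eigenvalue S) * x).
  by rewrite mulKf// gt_eqF.
by rewrite EFinM lee_wpmul2l// lee_fin invr_ge0 ltW.
Qed.

Lemma le_min_mule_pinfty (R : realType) (x k l e : \bar R) :
  (x <= mule_pinfty k e)%E -> (x <= mule_pinfty l e)%E ->
  (x <= mule_pinfty (Order.min k l) e)%E.
Proof. by rewrite minElt; case: ifP. Qed.

Section distance.
Context (R : realType) (dT : measure_display) (T : measurableType dT)
  (P : probability T R) (d : nat) (U V : {RV P >-> borelRV R d}).
Hypotheses (U1 : normalized P U) (V1 : normalized P V).

Lemma has_mean_distance :
  has_mean P (fun w => enorm (U w - V w) ^+ 2) (2 - 2 * \tr (Etensor P U V)).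
Proof.
apply: has_mean_eq (has_mean_residual 1 V1 U1) _ _ => [w|].
  by rewrite scale1r enorm_sqr.
by rewrite -(Etensor_tr U V) mxtrace_tr; ring.
Qed.

Lemma f_def_distance :
  f_def (fine ('E_P[fun w => (enorm (U w - V w) ^+ 2)%R])%E) =
  1 - \tr (Etensor P U V) ^+ 2.
Proof. by rewrite has_mean_distance.2 /f_def /=; field. Qed.

End distance.

Section degenerate_case.
Context (R : realType) (dT : measure_display) (T : measurableType dT)
  (P : probability T R) (d : nat) (U V Us Vs : {RV P >-> borelRV R d}).
Hypotheses (U1 : normalized P U) (V1 : normalized P V)
  (copy : iid_copy P (RV_pair U V) (RV_pair Us Vs)).

Lemma mean_distance0_ae_eq (X Y : {RV P >-> borelRV R d}) :
  has_mean P (fun w => dotv (X w - Y w) (X w - Y w)) 0 ->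
  {ae P, forall w, X w = Y w}.
Proof.
move=> [/Lfun1_integrable/integrableP[mD _] D0].
have : (fun w => (dotv (X w - Y w) (X w - Y w))%:E) = cst 0%E %[ae P in setT].
  apply/(ae_eq_integral_abs P measurableT mD); apply: etrans D0; rewrite unlock.
  by apply: eq_integral => w _; rewrite /= ger0_norm// dotvv_ge0.
apply: filterS => w /(_ I)[/dotvv_eq0 /eqP]; rewrite subr_eq0 => /eqP //.
Qed.

(** If t = 1 then U = V almost surely, and likewise for the copy, so that the
differences U - U' and V - V' with it coincide and their wedge vanishes. *)
Lemma trace1_expectation_misalignment : \tr (Etensor P U V) = 1 ->
  ('E_P[misalignment U V Us Vs] = 0)%E.
Proof.
move=> t1; have [ZZs _] := copy.
have D : has_mean P (fun w => dotv (U w - V w) (U w - V w)) 0.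
  apply: has_mean_eq (has_mean_distance U1 V1) _ _ => [w|]; first exact: enorm_sqr.
  by rewrite t1; ring.
have mD : measurable_fun setT
    (fun z : borelRV R d * borelRV R d => dotv (z.1 - z.2) (z.1 - z.2)).
  have mB i : measurable_fun setT
      (fun z : borelRV R d * borelRV R d => (z.1 - z.2) ord0 i).
    under eq_fun do rewrite !mxE.
    by apply: measurable_funB; exact: measurableT_comp (measurable_coord i) _.
  exact: measurable_dotv.
have Ds : has_mean P (fun w => dotv (Us w - Vs w) (Us w - Vs w)) 0.
  exact: (same_law_has_mean ZZs mD D).
rewrite unlock -(integral0 P setT).
apply: ae_eq_integral => //.
  exact/measurable_EFinP/measurable_misalignment.
apply: filterS2 (mean_distance0_ae_eq D) (mean_distance0_ae_eq Ds) => w UV UVs _.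
by rewrite /misalignment UV UVs !enorm_sqr -expr2 subrr.
Qed.

End degenerate_case.

Theorem proposition2p6 (R : realType) (disp : measure_display)
    (T : measurableType disp) (P : probability T R) (d : nat)
    (U V Us Vs : {RV P >-> borelRV R d}) :
  (2 <= d)%N ->
  centered P U -> centered P V ->
  normalized P U -> normalized P V ->
  iid_copy P (fun w => (U w, V w)) (fun w => (Us w, Vs w)) ->
  ((f_def (fine ('E_P[fun w => (enorm (U w - V w) ^+ 2)%R])%E))%:E
     <= bound P U V Us Vs)%E
  /\
  ({ae P, forall w, direction (U w) = direction (V w)} ->
   (Etensor P U V = d%:R^-1 *: 1%:M /\ Etensor P U U = d%:R^-1 *: 1%:M) \/
   (Etensor P U V = d%:R^-1 *: 1%:M /\ Etensor P V V = d%:R^-1 *: 1%:M) ->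
   (f_def (fine ('E_P[fun w => (enorm (U w - V w) ^+ 2)%R])%E))%:E
     = bound P U V Us Vs).
Proof.
move=> d2 Uc Vc U1 V1 copy.
have d0 : (0 < d)%N by apply: leq_trans d2.
rewrite f_def_distance// /bound -/(misalignment U V Us Vs).
set t := \tr (Etensor P U V).
have t1 : 0 <= 1 - t ^+ 2 by rewrite subr_ge0 correlation_sqr_le1.
split=> [|_ iso].
  have E_ge := expectation_misalignment_ge Uc Vc U1 V1 copy.
  (* E_ge and a gap at most lambda (1 - t ^+ 2) give twice the required bound *)
  have half_ge (S : 'M[R]_d) : max_eigenvalue S <= 1 ->
      \sum_i \sum_j Etensor P U U i j * Etensor P V V i j
        - \sum_i \sum_j Etensor P U V i j ^+ 2 <= max_eigenvalue S * (1 - t ^+ 2) ->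
      ((1 - t ^+ 2)%:E <= mule_pinfty (kappa S) 'E_P[misalignment U V Us Vs])%E.
    move=> lam1 gap; apply: le_mule_kappa => //; apply: le_trans E_ge.
    rewrite lee_fin -/t.
    have : 0 <= (1 - max_eigenvalue S) * (1 - t ^+ 2) by rewrite mulr_ge0// subr_ge0.
    by nra.
  apply: le_min_mule_pinfty; apply: half_ge; rewrite ?max_eigenvalue_Etensor_le1//.
    exact: trace_gap_le.
  have := trace_gap_le d0 V1 U1; rewrite -(Etensor_tr U V) mxtrace_tr -/t.
  apply: le_trans; rewrite le_eqVlt; apply/orP; left; apply/eqP.
  congr (_ - _).
    by apply: eq_bigr => i _; apply: eq_bigr => j _; rewrite mulrC.
  by rewrite exchange_big; apply: eq_bigr => i _; apply: eq_bigr => j _;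
    rewrite [X in _ = X ^+ 2]mxE.
have dR : d%:R != 0 :> R by rewrite pnatr_eq0 -lt0n.
have t_eq1 : t = 1.
  rewrite /t; suff -> : Etensor P U V = d%:R^-1 *: 1%:M.
    by rewrite mxtraceZ mxtrace1 mulVf.
  by case: iso => -[].
have kappa_fin (S : 'M[R]_d) : S = d%:R^-1 *: 1%:M -> (kappa S < +oo)%E.
  move=> ->; rewrite /kappa max_eigenvalue_scalar// ifF ?ltry//.
  by apply/negbTE; rewrite invr_eq1 (eqr_nat _ d 1) gtn_eqF.
(* both sides vanish once the smaller condition number is known to be finite *)
rewrite (trace1_expectation_misalignment U1 V1 copy t_eq1) /mule_pinfty mule0 ifF.
  by rewrite t_eq1 expr1n subrr.
by apply/negbTE; rewrite -ltey gt_min; case: iso => -[_ /kappa_fin ->]; rewrite ?orbT.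
Qed.
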